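(* Let $n\ge2$ and let $A\subset\mathbb R^n$ be closed with $\mathrm{Outrad}(A)<1$. Let $A_0=A$ and for $j=0,1,2,\dots$ define \[ A_{j+1}=\bigcup\{\mathrm{conv}_c(\{x,y\}):x,y\in A_j\}. \] Then $A_j\subseteq\mathrm{conv}_c(A)$ for all $j$, and $A_j=\mathrm{conv}_c(A)$ whenever $2^j>n$.
   Context: $B(x,r)$ is the closed Euclidean ball. For $A\subseteq\mathbb R^n$, $A^c=\bigcap_{x\in A}B(x,1)$ (with $\emptyset^c=\mathbb R^n$), and the $c$-hull is $\mathrm{conv}_c(A)=A^{cc}$. $\mathrm{Outrad}(A)$ is the infimum of $R$ such that $A\subseteq B(z,R)$ for some $z$. *)

(* Defs.v *)
From HB Require Import structures.
From mathcomp Require Import all_boot all_order all_algebra.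
From mathcomp Require Import all_classical all_reals all_analysis.
Import numFieldNormedType.Exports.
Set Implicit Arguments. Unset Strict Implicit. Unset Printing Implicit Defensive.
Import Order.TTheory GRing.Theory Num.Theory.
Local Open Scope classical_set_scope.
Local Open Scope ring_scope.

Section CHull.
Variables (R : realType) (n : nat).
Notation V := 'rV[R]_n.

Definition edist (x y : V) : R := Num.sqrt (\sum_(i < n) (x ord0 i - y ord0 i) ^+ 2).

Definition eball (x : V) (r : R) : set V := [set y | edist x y <= r].

Definition cdual (A : set V) : set V := [set y | forall x, A x -> eball x 1 y].

Definition conv_c (A : set V) : set V := cdual (cdual A).

Definition Outrad (A : set V) : \bar R :=
  ereal_inf [set r%:E | r in [set r : R | exists z : V, A `<=` eball z r]].

Fixpoint cseq (A : set V) (j : nat) : set V :=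
  match j with
  | O => A
  | j'.+1 => [set w | exists x y, cseq A j' x /\ cseq A j' y /\
                                   conv_c ([set x] `|` [set y]) w]
  end.
End CHull.

(* Main.v *)
(** Call [w] attached to weighted points [(x_i, a_i)] with barycenter [m] when
    [|w - m| <= 1] and [2 |w - m| <= \sum_i a_i |x_i - w| ^ 2]; then [w] lies in the
    c-hull of the [x_i], since a center [c] of a unit ball containing them satisfies
    [|c - m| ^ 2 <= 1 - Var <= (1 - |w - m|) ^ 2].  Conversely, invert [A] about a point
    [w] of its c-hull, sending [x] to [2 (x - w) / |x - w| ^ 2].  The convex hull of the
    image meets the closed unit ball, for otherwise its point of least norm yields a
    unit ball that contains [A] but not [w].  By Caratheodory's theorem, [w] is
    therefore attached to [n + 1] points of [A].

    To reach [w] in [j] steps, split [2 ^ j] points into two halves with inverted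
    barycenters [q1], [q2].  If the point [p] of least norm of [[q1, q2]] is an endpoint,
    one half suffices.  If [p = 0], [w] is on the segment joining the two barycenters.
    Otherwise [w] lies on a great arc of the sphere of radius [1 / |p| >= 1] centered at
    [w + p / |p| ^ 2], between the central projections of the barycenters of the two
    halves, and each projection is attached to its half. *)

Require Import Defs.
From HB Require Import structures.
From mathcomp Require Import all_boot all_order all_algebra.
From mathcomp Require Import ring lra.
From mathcomp Require Import all_classical all_reals all_analysis.
Import numFieldNormedType.Exports.
Import Order.TTheory GRing.Theory Num.Theory.
Local Open Scope classical_set_scope.
Local Open Scope ring_scope.
Set Implicit Arguments.
Unset Strict Implicit.

(** * Euclidean inner product, and c-hulls in terms of squared distances *)

Section Euclid.
Variables (R : realType) (n : nat).
Notation V := 'rV[R]_n.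

Definition dot (u v : V) : R := \sum_(i < n) u ord0 i * v ord0 i.
Local Notation nsq u := (dot u u).

Lemma dotC u v : dot u v = dot v u.
Proof. by apply: eq_bigr => i _; rewrite mulrC. Qed.

Lemma dotDl u v w : dot (u + v) w = dot u w + dot v w.
Proof. by rewrite /dot -big_split; apply: eq_bigr => i _; rewrite mxE mulrDl. Qed.

Lemma dotZl k u w : dot (k *: u) w = k * dot u w.
Proof. by rewrite /dot big_distrr; apply: eq_bigr => i _; rewrite mxE /= mulrA. Qed.

Lemma dotNl u w : dot (- u) w = - dot u w.
Proof. by rewrite -scaleN1r dotZl mulN1r. Qed.

Lemma dot0l w : dot 0 w = 0.
Proof. by rewrite -(scale0r (0 : V)) dotZl mul0r. Qed.

Lemma dotDr u v w : dot w (u + v) = dot w u + dot w v.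
Proof. by rewrite dotC dotDl !(dotC w). Qed.

Lemma dotZr k u w : dot w (k *: u) = k * dot w u.
Proof. by rewrite dotC dotZl dotC. Qed.

Lemma dotNr u w : dot w (- u) = - dot w u.
Proof. by rewrite dotC dotNl dotC. Qed.

Definition dotE := (dotDl, dotDr, dotNl, dotNr, dotZl, dotZr).

Lemma dot_suml (I : finType) (F : I -> V) w :
  dot (\sum_i F i) w = \sum_i dot (F i) w.
Proof.
by apply: (big_morph (fun u => dot u w)) => [u v|]; rewrite ?dotDl ?dot0l.
Qed.

Lemma nsqD u v : nsq (u + v) = nsq u + 2 * dot u v + nsq v.
Proof. by rewrite !dotE (dotC v u); ring. Qed.

Lemma nsq_ge0 u : 0 <= nsq u.
Proof. by apply: sumr_ge0 => i _; rewrite -expr2 sqr_ge0. Qed.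

Lemma nsq_eq0 u : nsq u = 0 -> u = 0.
Proof.
move=> /eqP; rewrite psumr_eq0; last by move=> i _; rewrite -expr2 sqr_ge0.
move=> /allP u0; apply/rowP => i; rewrite mxE.
by have := u0 i (mem_index_enum i); rewrite -expr2 sqrf_eq0 => /eqP.
Qed.

Lemma nsq_gt0 u : u != 0 -> 0 < nsq u.
Proof.
move=> u0; rewrite lt_neqAle nsq_ge0 andbT eq_sym.
by apply: contra u0 => /eqP/nsq_eq0 ->.
Qed.

Lemma nsqN u : nsq (- u) = nsq u.
Proof. by rewrite dotNl dotNr opprK. Qed.

Lemma nsqBC u v : nsq (u - v) = nsq (v - u).
Proof. by rewrite -nsqN opprB. Qed.

Lemma nsq_sqrt u : exists2 h, 0 <= h & nsq u = h ^+ 2.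
Proof. by exists (Num.sqrt (nsq u)); rewrite ?sqrtr_ge0 ?sqr_sqrtr ?nsq_ge0. Qed.

(** Cauchy-Schwarz, from the squared norm of [nsq v *: u - dot u v *: v]. Norms are bounded through
    their squares, which keeps later estimates polynomial. *)
Lemma dot_le u v (a b : R) : 0 <= a -> 0 <= b ->
  nsq u <= a ^+ 2 -> nsq v <= b ^+ 2 -> dot u v <= a * b.
Proof.
move=> a0 b0 ua vb; have [-> | vn0] := eqVneq v 0.
  by rewrite dotC dot0l mulr_ge0.
have v0 := nsq_gt0 vn0.
have CS : dot u v ^+ 2 <= nsq u * nsq v.
  have := nsq_ge0 (nsq v *: u - dot u v *: v); rewrite !dotE (dotC v u).
  set p := dot u v; set q := nsq v; set s := nsq u => h.
  have {}h : 0 <= q * (s * q - p ^+ 2) by lra.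
  by move: h; rewrite pmulr_rge0 // subr_ge0.
apply: le_trans (ler_norm _) _.
rewrite -(@ler_pXn2r _ 2) ?nnegrE ?mulr_ge0 // real_normK ?num_real //.
by apply: le_trans CS _; rewrite exprMn ler_pM ?nsq_ge0.
Qed.

Lemma nsqD_le u v (a b : R) : 0 <= a -> 0 <= b ->
  nsq u <= a ^+ 2 -> nsq v <= b ^+ 2 -> nsq (u + v) <= (a + b) ^+ 2.
Proof.
move=> a0 b0 ua vb; have := dot_le a0 b0 ua vb.
by rewrite nsqD => ?; nra.
Qed.

Lemma eballE (x y : V) r : 0 <= r -> eball x r y = (nsq (y - x) <= r ^+ 2) :> Prop.
Proof.
move=> r0; rewrite /eball /edist /=; congr (is_true _).
rewrite -[X in _ <= X]ger0_norm // -sqrtr_sqr ler_psqrt ?nnegrE ?sqr_ge0 //.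
  rewrite nsqBC; congr (_ <= _); apply: eq_bigr => i _; by rewrite !mxE expr2.
by apply: sumr_ge0 => i _; rewrite sqr_ge0.
Qed.

Lemma cdualE (A : set V) c : cdual A c <-> forall x, A x -> nsq (c - x) <= 1.
Proof.
by split=> h x Ax; have := h _ Ax; rewrite eballE // expr1n.
Qed.

Lemma conv_cE (A : set V) w : conv_c A w <->
  forall c, (forall x, A x -> nsq (c - x) <= 1) -> nsq (c - w) <= 1.
Proof.
split=> [/cdualE h c /cdualE/h|h]; first by rewrite nsqBC.
by apply/cdualE => c /cdualE/h; rewrite nsqBC.
Qed.

Lemma sub_conv_c (A : set V) : A `<=` conv_c A.
Proof. by move=> x Ax; apply/conv_cE => c /(_ _ Ax). Qed.

Lemma conv_c_sub (A B : set V) : A `<=` conv_c B -> conv_c A `<=` conv_c B.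
Proof.
move=> AB w /conv_cE Aw; apply/conv_cE => c cB.
by apply: Aw => x /AB/conv_cE; apply.
Qed.

Lemma cseq_sub_conv_c (A : set V) j : cseq A j `<=` conv_c A.
Proof.
elim: j => [|j IH]; first exact: sub_conv_c.
move=> w [x [y [/IH Ax [/IH Ay]]]].
by apply: conv_c_sub => _ [->|->].
Qed.

Lemma cseq_subS (A : set V) j : cseq A j `<=` cseq A j.+1.
Proof.
by move=> w Aw; exists w, w; do 2!split=> //; apply: sub_conv_c; left.
Qed.

(** The unit ball whose center is [z] moved away from [w] by [1 - r] still contains [A]. If [w] had
    distance [t > r] from [z], it would have distance [t + 1 - r > 1] from that center. *)
Lemma conv_c_ball (A : set V) z r : 0 <= r -> r < 1 ->
  (forall x, A x -> nsq (x - z) <= r ^+ 2) ->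
  forall w, conv_c A w -> nsq (w - z) <= r ^+ 2.
Proof.
move=> r0 r1 Az w /conv_cE Aw; rewrite leNgt; apply/negP => rw.
have [t t0 wt] := nsq_sqrt (w - z).
have rt : r < t by rewrite wt in rw; nra.
have tp : 0 < t by lra.
have /Aw : forall x, A x -> nsq (z - ((1 - r) / t) *: (w - z) - x) <= 1.
  move=> x /Az Ax; rewrite addrAC addrC.
  have -> : 1 = ((1 - r) + r) ^+ 2 :> R by ring.
  apply: nsqD_le => //; [lra| |by rewrite nsqBC].
  rewrite nsqN dotZl dotZr wt le_eqVlt; apply/orP; left; apply/eqP.
  by field; rewrite gt_eqF.
have -> : z - ((1 - r) / t) *: (w - z) - w = - (1 + (1 - r) / t) *: (w - z).
  by apply/rowP => i; rewrite !mxE; ring.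
rewrite dotZl dotZr wt.
have -> : - (1 + (1 - r) / t) * (- (1 + (1 - r) / t) * t ^+ 2) = (t + 1 - r) ^+ 2.
  by field; rewrite gt_eqF.
by move=> ?; nra.
Qed.

End Euclid.

(** * Weighted points and the points attached to them *)

Section Sagitta.
Variables (R : realType) (n : nat) (I : finType).
Notation V := 'rV[R]_n.
Local Notation nsq u := (dot u u).
Implicit Types (x : I -> V) (a : I -> R).

Definition weights a := (forall i, 0 <= a i) /\ \sum_i a i = 1.

Definition bary x a : V := \sum_i a i *: x i.

Definition moment x a c : R := \sum_i a i * nsq (x i - c).

(* With [d = |w - bary x a|] the last condition reads [1 - (1 - d) ^ 2 <= Var]: [d] is
   at most the sagitta of a unit arc over a chord of squared half-length [Var]. *)
Definition sagitta x a w := exists d,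
  [/\ 0 <= d, d <= 1, nsq (w - bary x a) = d ^+ 2 & 2 * d <= moment x a w].

Lemma dot_bary x a w : dot (bary x a) w = \sum_i a i * dot (x i) w.
Proof. by rewrite dot_suml; apply: eq_bigr => i _; rewrite dotZl. Qed.

(** Parallel axis identity; it turns a bound on a moment into a joint bound on the variance and on
    the position of the barycenter. *)
Lemma momentE x a c : \sum_i a i = 1 ->
  moment x a c = moment x a (bary x a) + nsq (bary x a - c).
Proof.
move=> a1; set m := bary x a.
have E b : moment x a b = \sum_i a i * nsq (x i) - 2 * dot m b + nsq b.
  have -> : nsq b = \sum_i a i * nsq b by rewrite -mulr_suml a1 mul1r.
  rewrite /moment dot_bary mulr_sumr -sumrB -big_split /=.
  by apply: eq_bigr => i _; rewrite !dotE (dotC b (x i)); ring.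
by rewrite !E !dotE (dotC c m); ring.
Qed.

Lemma moment_ge0 x a c : weights a -> 0 <= moment x a c.
Proof. by case=> a0 _; apply: sumr_ge0 => i _; rewrite mulr_ge0 ?nsq_ge0. Qed.

Lemma moment_le x a c (k : R) : weights a ->
  (forall i, 0 < a i -> nsq (x i - c) <= k) -> moment x a c <= k.
Proof.
move=> [a0 a1] xk; rewrite -[k]mul1r -a1 mulr_suml; apply: ler_sum => i _.
have [ai|ai|<-] := ltgtP 0 (a i); last by rewrite !mul0r.
  by rewrite ler_wpM2l // xk.
by have := a0 i; rewrite leNgt ai.
Qed.

Lemma sagitta_conv_c x a w (A : set V) : weights a ->
  (forall i, 0 < a i -> A (x i)) -> sagitta x a w -> conv_c A w.
Proof.
move=> wa xA [d [d0 d1 dw dm]]; apply/conv_cE => c cA.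
have [_ a1] := wa.
have cm : moment x a c <= 1.
  by apply: moment_le => // i ai; rewrite nsqBC cA //; exact: xA.
move: cm dm; rewrite (momentE _ c a1) (momentE _ w a1).
rewrite (nsqBC (bary x a) w) dw (nsqBC (bary x a) c) => cm dm.
rewrite (_ : c - w = (c - bary x a) + (bary x a - w)); last first.
  by rewrite addrA subrK.
have -> : 1 = (1 - d + d) ^+ 2 by ring.
apply: nsqD_le => //; [lra|nra|by rewrite nsqBC dw].
Qed.

Lemma moment_bary_le x a z (k : R) : weights a ->
  (forall i, 0 < a i -> nsq (x i - z) <= k) ->
  moment x a (bary x a) + nsq (bary x a - z) <= k.
Proof. by move=> wa xk; rewrite -momentE; [exact: moment_le|case: wa]. Qed.

(** With [h] the distance from [o] to the barycenter, the variance is [rho ^+ 2 - h ^+ 2] and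
    [d = rho - h]. The moment about [w] is then [2 * rho * d], at least [2 * d] since [rho >= 1];
    and [d ^+ 2] is at most the variance, which is below 1. *)
Lemma sagitta_arc x a z r o rho s w : weights a -> 0 <= r -> r < 1 ->
  (forall i, 0 < a i -> nsq (x i - z) <= r ^+ 2) ->
  1 <= rho -> moment x a o = rho ^+ 2 ->
  0 <= s -> w - o = s *: (bary x a - o) -> nsq (w - o) = rho ^+ 2 ->
  sagitta x a w.
Proof.
move=> wa r0 r1 xz rho1 xo s0 wo wrho; have [_ a1] := wa.
have V1 := moment_bary_le wa xz.
have V0 := moment_ge0 x (bary x a) wa.
have zm := nsq_ge0 (bary x a - z).
have [h h0 hE] := nsq_sqrt (bary x a - o).
move: xo; rewrite momentE // hE => xo.
have hrho : h <= rho by nra.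
have hs : s * h = rho.
  apply/eqP; rewrite -(@eqrXn2 _ 2) ?mulr_ge0 //; last lra.
  by rewrite -wrho wo dotZl dotZr hE; apply/eqP; ring.
have dE : nsq (w - bary x a) = (rho - h) ^+ 2.
  rewrite (_ : w - _ = (s - 1) *: (bary x a - o)).
    by rewrite dotZl dotZr hE -hs; ring.
  rewrite scalerBl -wo scale1r opprB addrA subrK //.
exists (rho - h); split=> //; [lra|nra|].
rewrite momentE // (nsqBC (bary x a) w) dE; nra.
Qed.

(** Only [d <= 1] is at stake. Let [h] be the distance from [z] to the barycenter. The variance is
    at least [2 * d - d ^+ 2] and at most [r ^+ 2 - h ^+ 2], so
    [h ^+ 2 <= (d - r) ^+ 2 - 2 * d * (1 - r)]. If [d > 1], this contradicts [d - r <= h]. *)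
Lemma sagitta_ball x a z r w d : weights a -> 0 <= r -> r < 1 ->
  (forall i, 0 < a i -> nsq (x i - z) <= r ^+ 2) -> nsq (w - z) <= r ^+ 2 ->
  0 <= d -> nsq (w - bary x a) = d ^+ 2 -> 2 * d <= moment x a w ->
  sagitta x a w.
Proof.
move=> wa r0 r1 xz wz d0 dE dm; exists d; split=> //.
have [_ a1] := wa.
have := moment_bary_le wa xz.
have [h h0 hE] := nsq_sqrt (bary x a - z).
move: dm; rewrite momentE // (nsqBC (bary x a) w) dE hE => dm Vr.
rewrite leNgt; apply/negP => d1.
have : nsq ((w - z) + (z - bary x a)) <= (r + h) ^+ 2.
  by apply: nsqD_le => //; rewrite nsqBC hE.
rewrite addrA subrK dE => dr.
have {}dr : d <= r + h by nra.
nra.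
Qed.

End Sagitta.

(** * The point of least norm on a segment *)

Definition segment_pt (R : realType) (n : nat) (q1 q2 : 'rV[R]_n) (t : R) :=
  t *: q1 + (1 - t) *: q2.

(** The squared norm along the segment is a quadratic in [t] that is smaller at [t0] than at both
    ends, so its vertex [- B / C] is interior. There [p] is orthogonal to [q1 - q2], which gives the
    two dot products. *)
Lemma segment_min_norm (R : realType) (n : nat) (q1 q2 : 'rV[R]_n) (t0 : R) :
  0 < t0 -> t0 < 1 -> 1 < dot q1 q1 -> 1 < dot q2 q2 ->
  dot (segment_pt q1 q2 t0) (segment_pt q1 q2 t0) <= 1 ->
  exists t, let p := segment_pt q1 q2 t in
    [/\ 0 < t, t < 1, dot p p <= 1, dot p q1 = dot p p & dot p q2 = dot p p].
Proof.
move=> t00 t01 q1g q2g; set seg := segment_pt q1 q2.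
pose B := dot q2 (q1 - q2); pose C := dot (q1 - q2) (q1 - q2).
have fE t : dot (seg t) (seg t) = dot q2 q2 + 2 * t * B + t ^+ 2 * C.
  by rewrite /seg /segment_pt /B /C !dotE (dotC q2 q1); ring.
rewrite fE => h.
have E1 : dot q1 q1 = dot q2 q2 + 2 * B + C.
  by rewrite /B /C !dotE (dotC q2 q1); ring.
have C0 : 0 <= C by exact: nsq_ge0.
have BC : 2 * B + t0 * C < 0.
  have : t0 * (2 * B + t0 * C) < 0 by lra.
  by rewrite pmulr_rlt0.
have B0 : B < 0 by nra.
have BC2 : 0 < 2 * B + (1 + t0) * C.
  have : 0 < (1 - t0) * (2 * B + (1 + t0) * C) by lra.
  by rewrite pmulr_rgt0 // subr_gt0.
have Cp : 0 < C by nra.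
have Bt : 0 < B + C by nra.
pose t := - B / C; have tC : t * C = - B by rewrite /t; field; rewrite gt_eqF.
have dpq : dot (seg t) q1 = dot (seg t) q2.
  apply/eqP; rewrite -subr_eq0 -dotNr -dotDr; apply/eqP.
  rewrite (_ : seg t = q2 + t *: (q1 - q2)); last first.
    by rewrite /seg /segment_pt; apply/rowP => i; rewrite !mxE; ring.
  by rewrite dotDl dotZl -/B -/C tC subrr.
have dpp : dot (seg t) (seg t) = dot (seg t) q2.
  by rewrite {2}/seg /segment_pt dotDr !dotZr dpq; ring.
exists t; split; rewrite ?dpq ?dpp //.
- by rewrite -(pmulr_lgt0 _ Cp) tC oppr_gt0.
- by rewrite -(ltr_pM2r Cp) tC mul1r; lra.
- rewrite -dpp fE; have : 0 <= C * (t - t0) ^+ 2 by rewrite mulr_ge0 ?sqr_ge0.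
  have -> : t ^+ 2 * C = - (t * B) by rewrite expr2 -mulrA tC mulrN.
  have -> : C * (t - t0) ^+ 2 = t * (t * C) - 2 * t0 * (t * C) + t0 ^+ 2 * C by ring.
  by rewrite tC; lra.
Qed.

(** * Joining two weighted families by one arc *)

Section Join.
Variables (R : realType) (n : nat) (z : 'rV[R]_n) (r : R).
Hypotheses (r0 : 0 <= r) (r1 : r < 1).
Notation V := 'rV[R]_n.
Local Notation nsq u := (dot u u).
Local Notation B := [set y : V | nsq (y - z) <= r ^+ 2].

Implicit Types (u v w o : V) (k s rho : R).

Definition mix (I : finType) (k : R) (a b : I -> R) i := k * a i + (1 - k) * b i.

Lemma weights_mix (I : finType) k (a b : I -> R) :
  0 <= k -> k <= 1 -> weights a -> weights b -> weights (mix k a b).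
Proof.
move=> k0 k1 [a0 a1] [b0 b1]; split=> [i|].
  by rewrite addr_ge0 // mulr_ge0 // subr_ge0.
by rewrite big_split /= -!mulr_sumr a1 b1; ring.
Qed.

Lemma bary_mix (I : finType) (x : I -> V) k a b :
  bary x (mix k a b) = k *: bary x a + (1 - k) *: bary x b.
Proof.
rewrite /bary !scaler_sumr -big_split; apply: eq_bigr => i _ /=.
by rewrite /mix scalerDl !scalerA.
Qed.

Lemma moment_mix (I : finType) (x : I -> V) k a b c :
  moment x (mix k a b) c = k * moment x a c + (1 - k) * moment x b c.
Proof.
by rewrite /moment !mulr_sumr -big_split; apply: eq_bigr => i _ /=; rewrite /mix; ring.
Qed.

Definition pair_pt (u v : V) (i : bool) := if i then u else v.
Definition pair_wt (k : R) (i : bool) := if i then k else 1 - k.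

Lemma weights_pair k : 0 <= k -> k <= 1 -> weights (pair_wt k).
Proof.
move=> k0 k1; split; first by case=> //=; rewrite subr_ge0.
by rewrite big_bool /=; ring.
Qed.

Lemma bary_pair u v k : bary (pair_pt u v) (pair_wt k) = k *: u + (1 - k) *: v.
Proof. by rewrite /bary big_bool. Qed.

Lemma conv_c_segment u v k : 0 <= k -> k <= 1 ->
  conv_c ([set u] `|` [set v]) (k *: u + (1 - k) *: v).
Proof.
move=> k0 k1; have kw := weights_pair k0 k1.
apply: (sagitta_conv_c (x := pair_pt u v) kw); first by case; [left|right].
exists 0; rewrite bary_pair subrr dot0l expr0n mulr0.
by split=> //; exact: moment_ge0.
Qed.

(** The endpoints lie at distance [rho] from [o], so any weights on them have moment [rho ^+ 2]
    about [o], and a point of the great arc is the central projection of a point of the chord. *)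
Lemma conv_c_arc u v o k s rho : B u -> B v -> 1 <= rho ->
  nsq (u - o) = rho ^+ 2 -> nsq (v - o) = rho ^+ 2 -> 0 <= k -> k <= 1 -> 0 <= s ->
  forall w, w - o = s *: (k *: (u - o) + (1 - k) *: (v - o)) ->
  nsq (w - o) = rho ^+ 2 -> conv_c ([set u] `|` [set v]) w.
Proof.
move=> Bu Bv rho1 uo vo k0 k1 s0 w wo wrho; have kw := weights_pair k0 k1.
apply: (sagitta_conv_c (x := pair_pt u v) kw); first by case; [left|right].
apply: (sagitta_arc (z := z) kw r0 r1 _ rho1 _ s0 _ wrho).
- by case.
- by rewrite /moment big_bool /= uo vo; ring.
- by rewrite wo bary_pair; congr (_ *: _); apply/rowP => i; rewrite !mxE; ring.
Qed.

Variables (I : finType) (x : I -> V).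
Hypothesis xB : forall i, B (x i).

Lemma sagitta_inB a w : weights a -> sagitta x a w -> B w.
Proof.
move=> wa sw; apply: (conv_c_ball r0 r1 (A := range x)).
  by move=> _ [i _ <-]; exact: xB.
by apply: (sagitta_conv_c wa _ sw) => i _; exists i.
Qed.

(** Inside the ball the clause [d <= 1] is automatic. What remains says that
    [(2 / moment x a w) *: (bary x a - w)] has norm at most 1; this vector is the barycenter of the
    points inverted about [w], reweighted by their squared distances to [w]. *)
Lemma sagitta_of_sqr a w : weights a -> B w ->
  4 * nsq (bary x a - w) <= moment x a w ^+ 2 -> sagitta x a w.
Proof.
move=> wa Bw; have [h h0 hE] := nsq_sqrt (bary x a - w); rewrite hE => hm.
apply: (sagitta_ball (z := z) wa r0 r1 (fun i _ => xB i) Bw h0).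
  by rewrite nsqBC.
by have := moment_ge0 x w wa; nra.
Qed.

(** The moment is positive because it dominates [nsq (bary x a - w)]; this permits the division by
    it that defines the inverted barycenter. *)
Lemma sagitta_of_sqrN a w : weights a -> B w ->
  ~ sagitta x a w -> 0 < moment x a w /\ moment x a w ^+ 2 < 4 * nsq (bary x a - w).
Proof.
move=> wa Bw ns.
have lt : moment x a w ^+ 2 < 4 * nsq (bary x a - w).
  by rewrite ltNge; apply/negP => /(sagitta_of_sqr wa Bw).
split=> //; have := moment_ge0 x w wa.
have [_ a1] := wa; have := momentE x w a1.
have := moment_ge0 x (bary x a) wa; have := nsq_ge0 (bary x a - w).
set s := nsq _ in lt *; set m := moment x a w in lt *; set v := moment _ _ _.
move=> *; nra.
Qed.

Lemma sagitta_bary a : weights a -> sagitta x a (bary x a).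
Proof.
move=> wa; exists 0; rewrite subrr dot0l expr0n mulr0.
by split=> //; exact: moment_ge0.
Qed.

(** The projection exists because the barycenter differs from [o]: the variance is at most
    [r ^+ 2 < 1], the moment about [o] at least 1. *)
Lemma sagitta_project a o rho : weights a -> 1 <= rho -> moment x a o = rho ^+ 2 ->
  exists s u, [/\ 0 < s, sagitta x a u, u - o = s *: (bary x a - o)
    & nsq (u - o) = rho ^+ 2].
Proof.
move=> wa rho1 ao; have [_ a1] := wa.
have [h h0 hE] := nsq_sqrt (bary x a - o).
have V1 := moment_bary_le (z := z) wa (fun i _ => xB i).
have := nsq_ge0 (bary x a - z); have := ao; rewrite momentE // hE => hrho m0.
have rr : r ^+ 2 < 1 by rewrite expr_lt1.
have rho2 : 1 <= rho ^+ 2 by rewrite expr_ge1 //; lra.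
have hp : 0 < h by rewrite lt_neqAle h0 andbT eq_sym -sqrf_eq0; apply/eqP; lra.
have uo : nsq ((rho / h) *: (bary x a - o)) = rho ^+ 2.
  by rewrite dotZl dotZr hE; field; rewrite gt_eqF.
have s0 : 0 < rho / h by rewrite divr_gt0 //; lra.
exists (rho / h), (o + (rho / h) *: (bary x a - o)).
rewrite addrAC subrr add0r; split=> //.
by apply: (sagitta_arc (z := z) (o := o) (rho := rho) wa r0 r1 (fun i _ => xB i)
  rho1 ao (ltW s0)); rewrite addrAC subrr add0r.
Qed.

Lemma sagitta_mix a b k w : weights a -> weights b -> 0 < k -> k < 1 ->
  sagitta x (mix k a b) w ->
  [\/ sagitta x a w, sagitta x b w |
   exists u v, [/\ sagitta x a u, sagitta x b v & conv_c ([set u] `|` [set v]) w]].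
Proof.
move=> wa wb k0 k1 sw.
have Bw : B w.
  by apply: sagitta_inB sw; apply: weights_mix => //; exact: ltW.
case: sw => d [d0 _]; rewrite nsqBC bary_mix moment_mix => dE dm.
have [?|/(sagitta_of_sqrN wa Bw)[]] := pselect (sagitta x a w); first exact: Or31.
have [?|/(sagitta_of_sqrN wb Bw)[]] := pselect (sagitta x b w); first by move=> *; exact: Or32.
set A1 := moment x a w in dm *; set A2 := moment x b w in dm *.
pose u1 := bary x a - w; pose u2 := bary x b - w; rewrite -/u1 -/u2.
move=> A20 A2u A10 A1u; apply: Or33.
have {}dE : nsq (k *: u1 + (1 - k) *: u2) = d ^+ 2.
  by rewrite -dE; congr dot; apply/rowP => i; rewrite !mxE; ring.
pose S := k * A1 + (1 - k) * A2.
have k1' : 0 < 1 - k by lra.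
have S0 : 0 < S by rewrite addr_gt0 // mulr_gt0.
have t0S : (1 - k * A1 / S) = (1 - k) * A2 / S by rewrite /S; field; rewrite -/S gt_eqF.
have nA1 : A1 != 0 by rewrite gt_eqF.
have nA2 : A2 != 0 by rewrite gt_eqF.
have nS : S != 0 by rewrite gt_eqF.
(* The endpoints are the inverted barycenters of [a] and [b], outside the unit ball as neither is
   attached to [w]. The parameter [k * A1 / S] gives the inverted barycenter of the mixture, which
   is in the unit ball. *)
have [|||||t] := @segment_min_norm _ _ ((2 / A1) *: u1) ((2 / A2) *: u2) (k * A1 / S).
- by rewrite divr_gt0 // mulr_gt0.
- by rewrite -subr_gt0 t0S divr_gt0 // mulr_gt0.
- rewrite dotZl dotZr (_ : _ * _ = (4 * nsq u1) / A1 ^+ 2); last by field.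
  by rewrite ltr_pdivlMr ?exprn_gt0 // mul1r.
- rewrite dotZl dotZr (_ : _ * _ = (4 * nsq u2) / A2 ^+ 2); last by field.
  by rewrite ltr_pdivlMr ?exprn_gt0 // mul1r.
- rewrite /segment_pt t0S !scalerA.
  rewrite (_ : _ + _ = (2 / S) *: (k *: u1 + (1 - k) *: u2)); last first.
    rewrite [in RHS]scalerDr !scalerA; congr (_ *: _ + _ *: _); field; exact/andP.
  rewrite dotZl dotZr dE (_ : _ * _ = (2 * d) ^+ 2 / S ^+ 2); last by field.
  by rewrite ler_pdivrMr ?exprn_gt0 // mul1r ler_pXn2r ?nnegrE ?mulr_ge0 // ltW.
rewrite /segment_pt /= !scalerA => -[t0 t1].
have t1' : 0 < 1 - t by lra.
set b1 := t * (2 / A1); set b2 := (1 - t) * (2 / A2); set p := _ + _.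
have b10 : 0 < b1 by rewrite mulr_gt0 // divr_gt0.
have b20 : 0 < b2 by rewrite mulr_gt0 // divr_gt0.
rewrite !dotZr => pp pu1 pu2.
(* Translates [p] back into a mixture: [k2] is chosen so that [p] is the inverted barycenter of
   [c]. *)
pose k2 := b1 / (b1 + b2).
have k2C : 1 - k2 = b2 / (b1 + b2) by rewrite /k2; field; rewrite gt_eqF // addr_gt0.
have bb0 : 0 < b1 + b2 by rewrite addr_gt0.
have nbb : b1 + b2 != 0 by rewrite gt_eqF.
have k20 : 0 < k2 by rewrite divr_gt0.
have k21 : k2 < 1 by rewrite -subr_gt0 k2C divr_gt0.
pose c := mix k2 a b.
have wc : weights c by apply: weights_mix => //; exact: ltW.
have cw : bary x c - w = (b1 + b2)^-1 *: p.
  rewrite bary_mix k2C /p scalerDr !scalerA /k2 /u1 /u2; apply/rowP => i; rewrite !mxE.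
  by field.
have mc : moment x c w = 2 / (b1 + b2).
  rewrite moment_mix k2C -/A1 -/A2 /k2.
  transitivity ((b1 * A1 + b2 * A2) / (b1 + b2)); first by field.
  congr (_ / _); rewrite /b1 /b2; field; exact/andP.
have sc : sagitta x c w.
  apply: sagitta_of_sqr => //; rewrite cw mc dotZl dotZr exprMn.
  rewrite (_ : 4 * _ = 4 * nsq p * (b1 + b2)^-1 ^+ 2); last by field.
  by rewrite ler_wpM2r ?sqr_ge0 //; lra.
have [p0|/eqP pn0] := pselect (p = 0).
  exists (bary x a), (bary x b); split; try exact: sagitta_bary.
  move: cw; rewrite p0 scaler0 => /eqP; rewrite subr_eq0 => /eqP <-.
  by rewrite bary_mix; apply: conv_c_segment; exact: ltW.
have [g g0 gE] := nsq_sqrt p.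
have gp : 0 < g.
  by rewrite lt_neqAle g0 andbT eq_sym; apply: contra pn0 => /eqP g0E;
    rewrite (nsq_eq0 (u := p)) // gE g0E expr0n.
have g1 : g <= 1 by nra.
have ng : g != 0 by rewrite gt_eqF.
(* The hyperplane of all [y] with [dot p y = dot p p] contains both inverted barycenters. Inversion
   about [w] turns it into this sphere, which passes through [w]. *)
pose rho := g^-1; pose o := w + (g ^+ 2)^-1 *: p.
have rho1 : 1 <= rho by rewrite invf_ge1.
have ow : w - o = - (g ^+ 2)^-1 *: p.
  by rewrite /o opprD addrA subrr sub0r scaleNr.
have wrho : nsq (w - o) = rho ^+ 2.
  by rewrite ow dotZl dotZr gE /rho; field.
(* The premise puts the inverted barycenter of [e] on the hyperplane; the conclusion is the sphere
   equation averaged over [e]. *)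
have mo e : weights e -> dot p (bary x e - w) = g ^+ 2 * moment x e w / 2 ->
    moment x e o = rho ^+ 2.
  case=> _ e1 pe; rewrite (momentE _ o e1).
  have := momentE x w e1 => E.
  have -> : bary x e - o = (bary x e - w) + (w - o) by rewrite addrA subrK.
  rewrite nsqD wrho ow dotZr (dotC _ p) pe.
  move: E; set v := moment x e (bary x e); set s := nsq _; set M := moment _ _ _ => ->.
  by rewrite /rho; field.
have ao : moment x a o = rho ^+ 2.
  apply: mo => //; rewrite -/u1 -/A1 -gE -pu1; by field.
have bo : moment x b o = rho ^+ 2.
  apply: mo => //; rewrite -/u2 -/A2 -gE -pu2; by field.
have [s1 [u [s10 su uo urho]]] := sagitta_project wa rho1 ao.
have [s2 [v [s20 sv vo vrho]]] := sagitta_project wb rho1 bo.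
exists u, v; split=> //.
(* Here [bary x c - o = (1 - kap) *: (w - o)], so [kap < 1] says that the barycenter of [c] and [w]
   are on the same side of [o]. Equality would put the barycenter at [o], against the variance
   bound; [kap <= 1] holds as [kap] is [g <= 1] times the distance from [w] to that barycenter. *)
pose kap := g ^+ 2 / (b1 + b2).
have kap1 : kap < 1.
  rewrite lt_neqAle; apply/andP; split.
    apply/eqP => kapE; have co : bary x c = o.
      apply/eqP; rewrite -subr_eq0 -(subrK w (bary x c)) -addrA ow cw -scalerDl.
      apply/eqP; rewrite (_ : _ + _ = (kap - 1) / g ^+ 2); last by rewrite /kap; field; apply/andP.
      by rewrite kapE subrr mul0r scale0r.
    have := moment_bary_le (z := z) wc (fun i _ => xB i).
    have rr : r ^+ 2 < 1 by rewrite expr_lt1.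
    have rho2 : 1 <= rho ^+ 2 by rewrite expr_ge1 //; lra.
    by rewrite co moment_mix ao bo; have := nsq_ge0 (o - z); lra.
  case: sc => e [e0 e1]; rewrite nsqBC cw dotZl dotZr gE => eE _.
  have : (g / (b1 + b2)) ^+ 2 <= 1.
    rewrite (_ : _ ^+ 2 = e ^+ 2); first by rewrite expr_le1.
    by rewrite -eE; field.
  rewrite expr_le1 //; last by rewrite divr_ge0 // ltW.
  rewrite (_ : kap = g * (g / (b1 + b2))); last by rewrite /kap; field.
  have : 0 <= g / (b1 + b2) by rewrite divr_ge0 // ltW.
  by move=> *; nra.
have kap1' : 0 < 1 - kap by lra.
have nkap : 1 - kap != 0 by rewrite gt_eqF.
have ns1 : s1 != 0 by rewrite gt_eqF.
have ns2 : s2 != 0 by rewrite gt_eqF.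
(* Expressed through the projections [u] and [v], the weights [k2] and [1 - k2] get divided by [s1]
   and [s2]; [G] normalizes them again. *)
pose G := k2 / s1 + (1 - k2) / s2.
have k2' : 0 < 1 - k2 by lra.
have G0 : 0 < G by rewrite addr_gt0 // divr_gt0.
have nG : G != 0 by rewrite gt_eqF.
pose l := k2 / s1 / G.
have lC : 1 - l = (1 - k2) / s2 / G.
  by rewrite /l -{1}(divff nG) -mulrBl {1}/G; congr (_ / _); ring.
apply: (conv_c_arc (o := o) (k := l) (s := G / (1 - kap)) (rho := rho)) => //.
- exact: sagitta_inB su.
- exact: sagitta_inB sv.
- by rewrite !divr_ge0 // ltW.
- by rewrite -subr_ge0 lC !divr_ge0 // ltW.
- by rewrite divr_ge0 // ltW.
rewrite lC uo vo !scalerA.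
have -> : l * s1 = k2 / G by rewrite /l; field; apply/andP.
have -> : (1 - k2) / s2 / G * s2 = (1 - k2) / G by field; apply/andP.
have -> : G / (1 - kap) *: ((k2 / G) *: (bary x a - o) + ((1 - k2) / G) *: (bary x b - o))
   = (1 - kap)^-1 *: (bary x c - o).
    by rewrite bary_mix; apply/rowP => i; rewrite !mxE; field; rewrite ng nkap nG.
rewrite -(subrK w (bary x c)) -addrA ow cw -scalerDl scalerA; congr (_ *: _).
have -> : (b1 + b2)^-1 - (g ^+ 2)^-1 = (kap - 1) / g ^+ 2 by rewrite /kap; field; apply/andP.
by field; apply/andP.
Qed.

End Join.

(** * Reaching an attached point in [j] steps by halving the support of the weights *)

Lemma sagitta_cseq (R : realType) (n : nat) (z : 'rV[R]_n) (r : R) (A : set 'rV[R]_n)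
    (I : finType) (x : I -> 'rV[R]_n) : 0 <= r -> r < 1 ->
  (forall y, A y -> dot (y - z) (y - z) <= r ^+ 2) -> (forall i, A (x i)) ->
  forall j (D : {set I}) a w, weights a -> (forall i, i \notin D -> a i = 0) ->
  (#|D| <= 2 ^ j)%N -> sagitta x a w -> cseq A j w.
Proof.
move=> r0 r1 Az xA; elim=> [|j IH] D a w wa aD.
  rewrite expn0 => D1 [d [d0 d1]]; have [_ sa] := wa.
  have [i0 i0D] : exists i0, i0 \in D.
    apply/set0Pn/eqP => D0; move: sa; rewrite big1 ?D0 => [/eqP|i _]; last first.
      by rewrite aD // D0 inE.
    by rewrite eq_sym oner_eq0.
  have a0 i : i != i0 -> a i = 0.
    move=> ii0; apply: aD; apply: contra ii0 => iD.
    by apply/eqP; move/card_le1_eqP: D1; apply.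
  have ai0 : a i0 = 1 by rewrite -sa (bigD1 i0) //= big1 ?addr0 // => i /a0.
  have -> : bary x a = x i0.
    rewrite /bary (bigD1 i0) //= ai0 scale1r big1 ?addr0 // => i /a0 ->.
    exact: scale0r.
  have -> : moment x a w = dot (w - x i0) (w - x i0).
    rewrite /moment (bigD1 i0) //= ai0 mul1r big1 ?addr0 => [|i /a0 ->]; last exact: mul0r.
    exact: nsqBC.
  move=> dE; rewrite dE => dd; suff : w = x i0 by move=> ->; exact: xA.
  (* With a single point the moment is [d ^+ 2], and [2 * d <= d ^+ 2] with [0 <= d <= 1] leaves
     only zero. *)
  have d00 : d = 0 by nra.
  by apply/eqP; rewrite -subr_eq0; apply/eqP/nsq_eq0; rewrite dE d00 expr0n.
rewrite expnS mul2n => Dj sw.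
have [D1 [D1D D1j D2j]] : exists D1 : {set I},
    [/\ D1 \subset D, (#|D1| <= 2 ^ j)%N & (#|D :\: D1| <= 2 ^ j)%N].
  pose s := take (2 ^ j) (enum D).
  have sD : [set i in s]%SET \subset D.
    by apply/fintype.subsetP => i; rewrite inE => /mem_take; rewrite mem_enum.
  have cs : #|[set i in s]%SET| = size s.
    by rewrite cardsE; apply/card_uniqP/take_uniq/enum_uniq.
  have size_s : size s = minn (2 ^ j) #|D|.
    by rewrite size_take_min -cardE.
  exists [set i in s]%SET; rewrite cardsD (finset.setIidPr sD) cs size_s; split=> //.
    exact: geq_minl.
  by rewrite leq_subLR /minn; case: ifP => _; rewrite ?addnn // leq_addr.
have [a0 sa] := wa.
pose l := \sum_(i in D1) a i; pose m := \sum_(i | i \notin D1) a i.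
have lm : m = 1 - l by move: sa; rewrite (bigID (mem D1)) /= => <-; rewrite addrAC subrr add0r.
have l0 : 0 <= l by exact: sumr_ge0.
have m0 : 0 <= m by exact: sumr_ge0.
(* A half of total weight zero cannot be normalized; the other half then carries all the weight. *)
have [lE|nl] := eqVneq l 0.
  apply: cseq_subS; apply: (IH (D :\: D1) a) => // i; rewrite inE negb_and negbK.
  case/orP => [iD1|]; last exact: aD.
  by apply/eqP; move/eqP: lE; rewrite psumr_eq0 // => /allP/(_ i (mem_index_enum i));
    rewrite iD1.
have [mE|nm] := eqVneq m 0.
  apply: cseq_subS; apply: (IH D1 a) => // i iD1.
  by apply/eqP; move/eqP: mE; rewrite psumr_eq0 // => /allP/(_ i (mem_index_enum i));
    rewrite iD1.
pose a1 i := if i \in D1 then a i / l else 0.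
pose a2 i := if i \in D1 then 0 else a i / m.
have w1 : weights a1.
  split=> [i|]; first by rewrite /a1; case: ifP => // _; rewrite divr_ge0.
  by rewrite -big_mkcond /= -mulr_suml divff.
have w2 : weights a2.
  split=> [i|]; first by rewrite /a2; case: ifP => // _; rewrite divr_ge0.
  rewrite -(divff nm) {2}/m mulr_suml [RHS]big_mkcond; apply: eq_bigr => i _.
  by rewrite /a2; case: ifP.
have aE : a = mix l a1 a2.
  apply/funext => i; rewrite /mix -lm /a1 /a2; case: ifP => _.
    by rewrite mulr0 addr0 mulrC divfK.
  by rewrite mulr0 add0r mulrC divfK.
rewrite aE in sw.
have lp : 0 < l by rewrite lt_neqAle eq_sym nl.
have l1 : l < 1 by rewrite -subr_gt0 -lm lt_neqAle eq_sym nm.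
have s1 v : sagitta x a1 v -> cseq A j v.
  by apply: IH w1 _ D1j => i; rewrite /a1 => /negbTE ->.
have s2 v : sagitta x a2 v -> cseq A j v.
  apply: IH w2 _ D2j => i; rewrite inE negb_and negbK /a2; case: ifP => //= iD1 iD.
  by rewrite aD // mul0r.
have [/s1|/s2|[u [v [/s1 u1 /s2 v2 uv]]]] :=
  sagitta_mix r0 r1 (fun i => Az _ (xA i)) w1 w2 lp l1 sw; try exact: cseq_subS.
by exists u, v.
Qed.

(** * Convex hulls with a fixed number of points: compactness and Caratheodory's theorem *)

Section ConvexHull.
Variables (R : realType) (n : nat).
Notation V := 'rV[R]_n.
Implicit Types A : set V.

Definition hull A k : set V := [set p | exists x : 'I_k.+1 -> V, (forall i, A (x i)) /\
  exists a, weights a /\ p = bary x a].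

Lemma sub_hull A k : A `<=` hull A k.
Proof.
move=> p Ap; exists (fun=> p); split=> //.
exists (fun i => (i == ord0)%:R); split.
  split=> [i|]; first exact: ler0n.
  by rewrite (bigD1 ord0) //= big1 ?addr0 // => i /negbTE ->.
rewrite /bary (bigD1 ord0) //= big1 ?addr0 ?scale1r // => i /negbTE ->.
exact: scale0r.
Qed.

(** Splitting off one point presents the hull as a continuous image of a product, from which
    compactness follows by induction. *)
Lemma hullS A k : hull A k.+1 =
  (fun u : R * V * V => segment_pt u.1.2 u.2 u.1.1) @` (`[0, 1] `*` A `*` hull A k).
Proof.
apply/seteqP; split=> [_ [x [xA [a [[a0 a1] ->]]]]|
    _ [[[t p] q] [[/= t01 Ap] [x [xA [a [[a0 a1] ->]]]] <-]]].
  rewrite /bary big_ord_recl; set t := a ord0.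
  have tE : \sum_i a (lift ord0 i) = 1 - t.
    by move: a1; rewrite big_ord_recl -/t => <-; rewrite addrAC subrr add0r.
  have t1 : 0 <= 1 - t by rewrite -tE sumr_ge0.
  (* If the remaining points have no weight, the first point itself fills the second slot. *)
  have [t1E|nt] := eqVneq (1 - t) 0.
    exists (t, x ord0, x ord0); first split=> /=; [split=> //=|exact: sub_hull|].
      by rewrite in_itv /= a0 -subr_ge0.
    rewrite /segment_pt t1E scale0r big1 // => i _.
    move/eqP: tE; rewrite t1E psumr_eq0 // => /allP/(_ i (mem_index_enum i))/eqP ->.
    exact: scale0r.
  exists (t, x ord0, bary (fun i => x (lift ord0 i)) (fun i => a (lift ord0 i) / (1 - t))).
    split=> /=; first by split=> //=; rewrite in_itv /= a0 -subr_ge0.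
    exists (fun i => x (lift ord0 i)); split=> //; eexists; split; last by [].
    split=> [i|]; first by rewrite divr_ge0.
    by rewrite -mulr_suml tE divff.
  rewrite /segment_pt /= /bary scaler_sumr; congr (_ + _); apply: eq_bigr => i _.
  by rewrite scalerA mulrC divfK.
move: t01; rewrite in_itv /= => /andP[t0 t1].
exists (fun i => if unlift ord0 i is Some j then x j else p); split.
  by move=> i; case: unliftP.
exists (fun i => if unlift ord0 i is Some j then (1 - t) * a j else t); split.
  split=> [i|]; first by case: unliftP => // j _; rewrite mulr_ge0 // subr_ge0.
  rewrite big_ord_recl unlift_none (eq_bigr (fun i => (1 - t) * a i)).
    by rewrite -mulr_sumr a1; ring.
  by move=> i _; rewrite liftK.
rewrite /segment_pt /bary [RHS]big_ord_recl unlift_none scaler_sumr; congr (_ + _).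
by apply: eq_bigr => i _; rewrite liftK scalerA.
Qed.

Lemma hull0 A : hull A 0 = A.
Proof.
apply/seteqP; split; last exact: sub_hull.
move=> _ [x [xA [a [[_ a1] ->]]]]; move: a1; rewrite /bary !big_ord1 => ->.
by rewrite scale1r.
Qed.

Lemma compact_hull A k : compact A -> compact (hull A k).
Proof.
move=> cA; elim: k => [|k IH]; first by rewrite hull0.
rewrite hullS; apply: continuous_compact; last first.
  by apply: compact_setX => //; apply: compact_setX => //; exact: segment_compact.
have c11 : continuous (fun u : R * V * V => u.1.1).
  by move=> u; apply: (@continuous_comp _ _ _ fst fst); exact: cvg_fst.
have c12 : continuous (fun u : R * V * V => u.1.2).
  by move=> u; apply: (@continuous_comp _ _ _ fst snd); [exact: cvg_fst|exact: cvg_snd].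
apply: continuous_subspaceT => u; rewrite /segment_pt.
apply: cvgD; apply: cvgZ; [exact: c11|exact: c12| |exact: cvg_snd].
by apply: cvgB; [exact: cvg_cst|exact: c11].
Qed.

(** In dimension [n], [n.+2] points have an affine dependence [g]. Subtracting the largest multiple
    of [g] that keeps all weights nonnegative makes one weight vanish. *)
Lemma hull_caratheodory A : hull A n.+1 `<=` hull A n.
Proof.
move=> _ [x [xA [a [[a0 a1] ->]]]].
(* The column of ones forces the coefficients of a kernel vector to sum to zero. *)
pose M : 'M[R]_(n.+2, n + 1) := row_mx (\matrix_(i, j) x i ord0 j) (const_mx 1).
have [g gM [i1 gi1]] : exists2 g : 'rV[R]_n.+2, g *m M = 0 & exists i, 0 < g ord0 i.
  have : kermx M != 0.
    rewrite -mxrank_eq0 mxrank_ker -lt0n subn_gt0.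
    by apply: leq_ltn_trans (rank_leq_col M) _; rewrite addn1.
  case/rowV0Pn => g /sub_kermxP gM g0.
  have [[i gi]|h] := pselect (exists i, 0 < g ord0 i); first by exists g => //; exists i.
  exists (- g); first by rewrite mulNmx gM oppr0.
  have /rV0Pn[i gi] := g0; exists i; rewrite mxE oppr_gt0 lt_neqAle gi /= leNgt.
  by apply/negP => ?; apply: h; exists i.
move: gM; rewrite mul_mx_row -[0]hsubmxK => /eq_row_mx [].
rewrite !linear0 => gx g1.
have {}g1 : \sum_i g ord0 i = 0.
  move/matrixP/(_ ord0 ord0): g1; rewrite !mxE => E; rewrite -[RHS]E.
  by apply: eq_bigr => i _; rewrite mxE mulr1.
have {}gx : \sum_i g ord0 i *: x i = 0.
  apply/rowP => j; move/rowP/(_ j): gx; rewrite !mxE summxE => E; rewrite -[RHS]E.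
  by apply: eq_bigr => i _; rewrite !mxE.
pose P i := 0 < g ord0 i.
case: (arg_minP (fun i => a i / g ord0 i) (gi1 : P i1)) => i0 gi0 mini0.
pose t := a i0 / g ord0 i0; pose b i := a i - t * g ord0 i.
have t0 : 0 <= t by rewrite divr_ge0 // ltW.
have b0 i : 0 <= b i.
  rewrite subr_ge0; have [gi|gi] := ltP 0 (g ord0 i).
    by rewrite -ler_pdivlMr //; exact: mini0.
  by apply: le_trans (a0 i); rewrite mulr_ge0_le0.
have bi0 : b i0 = 0 by rewrite /b /t divfK ?subrr // gt_eqF.
exists (x \o lift i0); split=> [i|]; first exact: xA.
exists (b \o lift i0); split.
  split=> [i|]; first exact: b0.
  transitivity (\sum_i b i); first by rewrite (bigD1_ord i0) //= bi0 add0r.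
  by rewrite sumrB -mulr_sumr g1 mulr0 subr0.
transitivity (\sum_i b i *: x i); last by rewrite (bigD1_ord i0) //= bi0 scale0r add0r.
under [RHS]eq_bigr do rewrite scalerBl -scalerA.
by rewrite sumrB -scaler_sumr gx scaler0 subr0.
Qed.

End ConvexHull.

(** * Inversion, and a Caratheodory theorem for c-hulls *)

Section Caratheodory.
Variables (R : realType) (n : nat).
Notation V := 'rV[R]_n.
Local Notation nsq u := (dot u u).

Lemma continuous_nsqB (w : V) : continuous (fun y : V => nsq (y - w)).
Proof.
rewrite (_ : (fun _ => _) =
    fun y : V => \sum_i (y ord0 i - w ord0 i) * (y ord0 i - w ord0 i)); last first.
  by apply/funext => y; apply: eq_bigr => i _; rewrite !mxE.
apply: continuous_big => [|i _ y]; first exact: add_continuous.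
have ci : continuous (fun v : V => v ord0 i - w ord0 i).
  by move=> v; apply: (cvgB (F := nbhs v)); [exact: coord_continuous|exact: cvg_cst].
by apply: (cvgM (F := nbhs y)); exact: ci.
Qed.

Lemma closed_ball_compact (A : set V) z r : closed A ->
  (forall y, A y -> nsq (y - z) <= r ^+ 2) -> compact A.
Proof.
move=> clA Az; apply: bounded_closed_compact => //.
(* The ambient norm is the maximum norm, and each coordinate is bounded by the Euclidean length. *)
exists (`|z| + `|r|); split; first exact: num_real.
move=> M /ltW ltM y /Az yz; apply: le_trans ltM.
rewrite -(subrK z y) addrC; apply: le_trans (ler_normD _ _) _; rewrite lerD2l.
rewrite [X in X <= _]/Num.norm /=.
have [->|/mx_norm_neq0[[i j] /= ->]] := eqVneq (mx_norm (y - z)) 0; first exact: normr_ge0.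
rewrite -(@ler_pXn2r _ 2) ?nnegrE // !real_normK ?num_real //.
apply: le_trans yz; rewrite /dot (bigD1 j) //= (ord1 i) -expr2 lerDl.
by apply: sumr_ge0 => k _; rewrite -expr2 sqr_ge0.
Qed.

(** Inversion in the sphere of squared radius 2 about [w], with [w] moved to the origin. The factor
    2 sends unit spheres through [w] to hyperplanes at distance 1 from the origin. *)
Definition inversion (w y : V) : V := (2 / nsq (y - w)) *: (y - w).

Lemma inversionE (w y : V) : y != w ->
  0 < nsq (y - w) /\ (2 / nsq (inversion w y)) *: inversion w y = y - w.
Proof.
rewrite -subr_eq0 => /nsq_gt0; rewrite /inversion; move: (y - w) => u u0.
have nu : nsq u != 0 by rewrite gt_eqF.
have E : nsq ((2 / nsq u) *: u) = 4 / nsq u by rewrite dotZl dotZr; field.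
by split=> //; rewrite E scalerA (_ : _ * _ = 1) ?scale1r //; field.
Qed.

Lemma compact_inversion (A : set V) w : compact A -> ~ A w -> compact (inversion w @` A).
Proof.
move=> cA nAw; apply: continuous_compact => //.
apply: continuous_in_subspaceT => y; rewrite inE => Ay.
have yw : y != w by apply: contra_notN nAw => /eqP <-.
apply: (cvgZ (F := nbhs y)); last by apply: (cvgB (F := nbhs y)); [exact: cvg_id|exact: cvg_cst].
apply: (cvgM (F := nbhs y)); first exact: cvg_cst.
by apply: (cvgV (F := nbhs y));
  [rewrite gt_eqF //; have [] := inversionE yw|exact: continuous_nsqB].
Qed.

(** The variational inequality for a point of least norm: otherwise a small step towards [q] would
    shorten [p]. *)
Lemma dot_ge_of_min (p q : V) :
  (forall t, 0 <= t -> t <= 1 -> nsq p <= nsq (segment_pt q p t)) -> nsq p <= dot p q.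
Proof.
move=> h; rewrite -subr_ge0 -dotNr -dotDr; set D := dot p (q - p).
have C0 := nsq_ge0 (q - p); set C := nsq (q - p) in C0.
have fE t : nsq (segment_pt q p t) = nsq p + 2 * t * D + t ^+ 2 * C.
  by rewrite /segment_pt /D /C !dotE (dotC q p); ring.
rewrite leNgt; apply/negP => D0.
have CD : 0 < C - D by lra.
(* This step stays in the unit interval even when [C = 0], and changes the squared norm by
   [(1 + t) * t * D < 0]. *)
pose t := - D / (C - D); have tE : t * (C - D) = - D by rewrite divfK // gt_eqF.
have t0 : 0 < t by rewrite divr_gt0 //; lra.
have t1 : t <= 1 by rewrite ler_pdivrMr //; lra.
have := h t (ltW t0) t1; rewrite fE.
have -> : t ^+ 2 * C = t * (- D + t * D) by rewrite -tE; ring.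
have : t * D < 0 by rewrite pmulr_rlt0.
set s := t * D => s0.
have -> : 2 * t * D = 2 * s by rewrite /s; ring.
have -> : t * (- D + s) = - s + t * s by rewrite /s; ring.
by nra.
Qed.

Lemma compact_min_nsq (K : set V) w : K !=set0 -> compact K ->
  exists2 p, K p & forall q, K q -> nsq (p - w) <= nsq (q - w).
Proof.
move=> K0 cK; have [|p /set_mem Kp pmin] := EVT_min_rV (f := fun y => nsq (y - w)) K0 cK.
  by apply: continuous_subspaceT; exact: continuous_nsqB.
by exists p => // q Kq; apply: pmin; exact/mem_set.
Qed.

Lemma conv_c_sagitta (A : set V) z r w : 0 <= r -> r < 1 ->
  (forall y, A y -> nsq (y - z) <= r ^+ 2) -> closed A -> A !=set0 -> conv_c A w ->
  exists x : 'I_n.+1 -> V, (forall i, A (x i)) /\ exists a, weights a /\ sagitta x a w.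
Proof.
move=> r0 r1 Az clA A0 Aw; have cA := closed_ball_compact clA Az.
have [/(sub_hull n) [x [xA [a [wa ->]]]]|nAw] := pselect (A w).
  by exists x; split=> //; exists a; split=> //; exact: sagitta_bary.
have neqw y : A y -> y != w by move=> Ay; apply: contra_notN nAw => /eqP <-.
have cK : compact (hull (inversion w @` A) n) by exact/compact_hull/compact_inversion.
have K0 : hull (inversion w @` A) n !=set0.
  by have [y Ay] := A0; exists (inversion w y); apply: sub_hull; exists y.
have [p Kp pmin] := compact_min_nsq 0 K0 cK.
(* A segment from [p] to an inverted point uses one point too many; Caratheodory's theorem brings it
   back into the hull over which [p] is minimal. *)
have {}pmin y : A y -> nsq p <= dot p (inversion w y).
  move=> Ay; apply: dot_ge_of_min => t t0 t1.
  rewrite -[X in nsq X <= _]subr0 -[X in _ <= nsq X]subr0; apply: pmin.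
  apply: hull_caratheodory; rewrite hullS; exists (t, inversion w y, p) => //.
  by split=> //; split=> /=; [rewrite in_itv /= t0|exists y].
have [p1|p1] := leP (nsq p) 1; last first.
  have [y0 Ay0 y0min] := compact_min_nsq w A0 cA.
  have [d0 _] := inversionE (neqw _ Ay0); set d := nsq _ in d0.
  have [g g0 gE] := nsq_sqrt p; have g1 : 1 < g by rewrite gE in p1; nra.
  have ng : g != 0 by rewrite gt_eqF //; lra.
  (* The unit ball to be built has its center at distance [1 + e] from [w] in the direction of [p].
     A point of [A] at squared distance [N >= d] from [w] has squared distance at most
     [(1 + e) ^+ 2 - (g - 1) * N] from that center, so [2 * e + e ^+ 2 <= k] suffices. *)
  pose k := (g - 1) * d; have k0 : 0 < k by rewrite mulr_gt0 // subr_gt0.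
  pose e := k / (3 + k); have eE : e * (3 + k) = k by rewrite divfK // gt_eqF //; lra.
  have e0 : 0 < e by rewrite divr_gt0 //; lra.
  have e1 : e < 1 by rewrite ltr_pdivrMr; lra.
  have ek : 2 * e + e ^+ 2 <= k by nra.
  suff : nsq (w + ((1 + e) / g) *: p - w) <= 1.
    rewrite addrAC subrr add0r dotZl dotZr gE.
    rewrite (_ : (1 + e) / g * _ = (1 + e) ^+ 2); last by field.
    by move=> ?; nra.
  move/conv_cE: Aw; apply=> y Ay.
  have [N0 _] := inversionE (neqw _ Ay); have Nd := y0min _ Ay.
  rewrite (_ : w + _ - y = ((1 + e) / g) *: p - (y - w)); last first.
    by apply/rowP => i; rewrite !mxE; ring.
  have := pmin _ Ay; rewrite /inversion dotZr gE.
  move: (y - w) N0 Nd => u; rewrite -/d; set N := nsq u => N0 Nd.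
  rewrite mulrAC ler_pdivlMr // => gN.
  rewrite (_ : dot _ _ = (1 + e) ^+ 2 - (1 + e) / g * (2 * dot p u) + N); last first.
    rewrite !dotE (dotC u p) gE -/N; by field.
  have gN2 : (1 + e) * g * N <= (1 + e) / g * (2 * dot p u).
    rewrite (_ : _ * N = (1 + e) / g * (g ^+ 2 * N)); last by field.
    by rewrite ler_wpM2l // divr_ge0 //; lra.
  have : (g - 1) * d <= (g - 1) * N by rewrite ler_wpM2l // subr_ge0 ltW.
  have : 0 <= e * g * N by exact: (mulr_ge0 (mulr_ge0 (ltW e0) g0) (ltW N0)).
  by rewrite -/k; lra.
have [y [yA [a [[a0 a1] pE]]]] := Kp.
pose x i := w + (2 / nsq (y i)) *: y i.
have xP i : [/\ A (x i), 0 < nsq (x i - w) & inversion w (x i) = y i].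
  have [v Av vy] := yA i; have [v0 vE] := inversionE (neqw _ Av).
  have -> : x i = v by rewrite /x -vy vE addrC subrK.
  by [].
(* Undoes the reweighting caused by inversion: after normalization the moment about [w] is [E^-1]
   and the barycenter is [w + (2 * E)^-1 *: p], so attachment reads [nsq p <= 1]. *)
pose e i := a i / nsq (x i - w); pose E := \sum_i e i.
have e0 i : 0 <= e i by have [_ /ltW ? _] := xP i; rewrite divr_ge0.
have E0 : 0 < E.
  rewrite lt_neqAle sumr_ge0 // andbT eq_sym; apply/eqP => /eqP.
  rewrite psumr_eq0 // => /allP e00; move: a1; rewrite big1 => [/eqP|i _].
    by rewrite eq_sym oner_eq0.
  have [_ N0 _] := xP i; have := e00 i (mem_index_enum i).
  by rewrite mulf_eq0 invr_eq0 (gt_eqF N0) orbF => /eqP.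
have nE : E != 0 by rewrite gt_eqF.
have wa : weights (fun i => e i / E).
  split=> [i|]; first by rewrite divr_ge0 // ltW.
  by rewrite -mulr_suml divff.
exists x; split=> [i|]; first by have [] := xP i.
exists (fun i => e i / E); split=> //.
apply: (sagitta_of_sqr (z := z) r0 r1) => //.
- by move=> i; have [Ax _ _] := xP i; exact: Az.
- exact: (conv_c_ball r0 r1 Az).
have -> : moment x (fun i => e i / E) w = E^-1.
  rewrite -[RHS]mul1r -a1 mulr_suml; apply: eq_bigr => i _.
  have [_ N0 _] := xP i; rewrite /e; field; by rewrite nE gt_eqF.
have -> : bary x (fun i => e i / E) - w = (2 * E)^-1 *: p.
  have wE : w = \sum_i (e i / E) *: w.
    by have [_ s1] := wa; rewrite -scaler_suml s1 scale1r.
  rewrite pE /bary [X in _ - X]wE -sumrB.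
  rewrite scaler_sumr; apply: eq_bigr => i _.
  have [_ N0 <-] := xP i; rewrite -scalerBr /inversion !scalerA; congr (_ *: _).
  by rewrite /e; field; rewrite nE gt_eqF.
rewrite dotZl dotZr (_ : 4 * _ = nsq p * E^-1 ^+ 2); last by field.
by rewrite ler_piMl // sqr_ge0.
Qed.

End Caratheodory.

(** * Both inclusions, with the empty set treated apart *)

Unset Implicit Arguments.

Theorem theorem4p25 (R : realType) (n : nat) (A : set 'rV[R]_n) :
  (2 <= n)%N -> closed A -> (Outrad A < 1%:E)%E ->
  (forall j : nat, cseq A j `<=` conv_c A) /\
  (forall j : nat, (n < 2 ^ j)%N -> cseq A j = conv_c A).
Proof.
move=> n2 clA /ereal_inf_lt[_ [r [z Az] <-]]; rewrite lte_fin => r1.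
split=> [j|j nj]; first exact: cseq_sub_conv_c.
apply/seteqP; split=> [|w Aw]; first exact: cseq_sub_conv_c.
(* If [A] is empty, every point is an admissible center; the one with all coordinates shifted by 2
   has squared distance [4 * n > 1] from [w], so the hull is empty too. *)
have [A0|nA] := pselect (A !=set0); last first.
  have : dot (w + const_mx 2 - w) (w + const_mx 2 - w) <= 1.
    by move/conv_cE: Aw; apply=> x Ax; case: nA; exists x.
  rewrite addrAC subrr add0r /dot.
  under eq_bigr do rewrite mxE.
  rewrite sumr_const card_ord => h; exfalso; move: h; apply/negP; rewrite -ltNge.
  have n2' : 2 <= n%:R :> R by rewrite (ler_nat R 2).
  by rewrite -mulr_natr; lra.
have r0 : 0 <= r.
  by have [x /Az xr] := A0; apply: le_trans xr; exact: sqrtr_ge0.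
have {}Az y : A y -> dot (y - z) (y - z) <= r ^+ 2 by move=> /Az; rewrite eballE.
have [x [xA [a [wa sw]]]] := conv_c_sagitta r0 r1 Az clA A0 Aw.
(* All [n.+1] indices serve as support, and [n < 2 ^ j] is exactly [n.+1 <= 2 ^ j]. *)
apply: (sagitta_cseq r0 r1 Az xA (D := [set: _]%SET) wa _ _ sw) => [i|]; first by rewrite inE.
by rewrite cardsT card_ord.
Qed.
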